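(* Let $\mathbb{T}=[0,\infty)$ with $\tau(ds)=ds$, or $\mathbb{T}=\mathbb{N}_0$ with $\tau$ the counting measure on $\mathbb{T}$. Let $\Theta\subset\mathbb{R}^d$ be a parameter set, $(\Omega,\mathcal{F},\mathbb{P}_\theta)_{\theta\in\Theta}$ a family of probability spaces, and let $(Y_t)_{t\in\mathbb{T}}$ be an $\mathbb{R}$-valued measurable process on $(\Omega,\mathcal{F},\mathbb{P}_\theta)$ for each $\theta\in\Theta$. Suppose that $\sup_{\theta\in\Theta}\sup_{t\in\mathbb{T}}\mathbb{E}_\theta[|Y_t|^2]<\infty$ and that there exists $m:\Theta\to\mathbb{R}$ such that $$\lim_{t\to\infty}\sup_{\theta\in\Theta}\left|\frac1t\int_{[0,t)}\mathbb{E}_\theta[Y_s]\tau(ds)-m(\theta)\right|=0 .$$ If $$\lim_{t\to\infty}\sup_{\theta\in\Theta}\frac1{t^2}\int_{[0,t)^2}\mathrm{cov}_\theta(Y_s,Y_u)\,\tau(du)\tau(ds)=0,$$ then $$\lim_{t\to\infty}\sup_{\theta\in\Theta}\mathbb{E}_\theta\left[\left|\frac1t\int_{[0,t)}Y_s\tau(ds)-m(\theta)\right|^2\right]=0 .$$ Moreover, if there exist $p\in[2,\infty)$ and $\varepsilon>0$ such that $\sup_{\theta\in\Theta}\sup_{t\in\mathbb{T}}\mathbb{E}_\theta[|Y_t|^{p+\varepsilon}]<\infty$, then even $$\lim_{t\to\infty}\sup_{\theta\in\Theta}\mathbb{E}_\theta\left[\left|\frac1t\int_{[0,t)}Y_s\tau(ds)-m(\theta)\right|^p\right]=0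 .$$
   Context: $\mathbb{E}_\theta$ and $\mathrm{cov}_\theta$ denote expectation and covariance with respect to $\mathbb{P}_\theta$. *)

(* Defs.v *)
From HB Require Import structures.
From mathcomp Require Import all_boot all_order all_algebra.
From mathcomp Require Import all_classical all_reals all_analysis.

Set Implicit Arguments.
Unset Strict Implicit.
Unset Printing Implicit Defensive.

Import Order.TTheory GRing.Theory Num.Theory.
Import numFieldNormedType.Exports.

Local Open Scope classical_set_scope.
Local Open Scope ring_scope.

(* Both time sets are subsets of the real line.  Integrals are only ever taken
   over subsets of [T], so in the discrete case [tau] may be the counting
   measure of the whole line.  The Borel sigma-algebra induces on [T = N] the
   discrete one. *)
Definition time_setting (R : realType) (T : set (measurableTypeR R))
    (tau : {measure set (measurableTypeR R) -> \bar R}) : Prop :=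
  (T = [set s : R | 0 <= s] /\ tau = lebesgue_measure) \/
  (T = range (fun n : nat => n%:R : R) /\ tau = counting).

Definition before (R : realType) (T : set (measurableTypeR R)) (t : R) :
    set (measurableTypeR R) :=
  T `&` `[0, t[%classic.

(* [Y s] is only meaningful for [s] in [T]; measurability is joint in time and
   outcome. *)
Definition measurable_process (R : realType) (d : measure_display)
    (Omega : measurableType d) (T : set (measurableTypeR R))
    (Y : R -> Omega -> R) : Prop :=
  measurable_fun (T `*` [set: Omega])
    (fun z : measurableTypeR R * Omega => Y z.1 z.2 : measurableTypeR R).

(* The limit of [f t] as [t] tends to infinity inside [T] is 0. *)
Definition tends_to_0 (R : realType) (T : set R) (f : R -> \bar R) : Prop :=
  f t @[t --> within T (pinfty_nbhs R)] --> (0 : \bar R)%E.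

(* The pathwise time average over [0, t) /\ T.  It is real-valued: under a
   uniform first moment bound almost every path is integrable on [0, t). *)
Definition time_average (R : realType) (T : set (measurableTypeR R))
    (tau : {measure set (measurableTypeR R) -> \bar R}) (Omega : Type)
    (Y : R -> Omega -> R) (t : R) (w : Omega) : R :=
  t^-1 * \int[tau]_(s in before T t) (Y s w).

(* Main.v *)
Require Import Defs.
From HB Require Import structures.
From mathcomp Require Import all_boot all_order all_algebra.
From mathcomp Require Import all_classical all_reals all_analysis.
From mathcomp Require Import measurable_realfun ring lra.

Set Implicit Arguments.
Unset Strict Implicit.
Unset Printing Implicit Defensive.

Import Order.TTheory GRing.Theory Num.Theory.
Import numFieldNormedType.Exports.

Local Open Scope classical_set_scope.
Local Open Scope ring_scope.

(** For a fixed horizon t > 0 in the time set, the interval [0, t) has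
    tau-mass t, in continuous and in discrete time alike.  Let nu be the uniform
    law on it, that is, tau restricted to [0, t) and divided by t.  Then the
    time average is the nu-average of the paths, and the prefactors 1/t and
    1/t^2 of the two hypotheses disappear when tau is replaced by nu.  From
    here on everything concerns a jointly measurable function X(s, w) under two
    probability measures, nu in time and P in the outcome.

    Mean square convergence.  Let e(s) be the mean of X(s, .) and
    h(s, w) = X(s, w) - e(s).  Two applications of Fubini's theorem turn the
    double integral of the covariances E[h(s, .) h(u, .)] into the second moment
    of the average of h ([double_integral_mul]).  For almost every w the
    average of X minus m is the average of h plus the bias, which is the
    nu-average of e minus m.  Hence its second moment is at most twice the
    averaged covariance plus twice the squared bias ([mean_square_le]).  This
    bound is the same for every theta, so both hypotheses pass to the supremum.

    Convergence in L^p.  By Jensen's inequality and Tonelli's theorem the time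
    averages inherit the bound on the moments of order q = p + eps
    ([average_moment_le]), and m is bounded because it is a uniform limit of
    averaged means.  The centred time averages are thus bounded in L^q.  For
    every level l > 0,
      x^p <= l^(p-2) x^2 + l^(-eps) x^(p+eps)      (x >= 0),
    so that choosing first l large and then t large makes the p-th moment small
    uniformly in theta. *)

(** * Elementary inequalities *)

Lemma powR_norm2 (R : realType) (x : R) : `|x| `^ 2 = x ^+ 2.
Proof. by rewrite powR_mulrn// real_normK// num_real. Qed.

Lemma sqrB_le (R : realDomainType) (a b : R) :
  (a - b) ^+ 2 <= 2 * a ^+ 2 + 2 * b ^+ 2.
Proof. by have := sqr_ge0 (a + b); rewrite !expr2; nra. Qed.

(** The first term dominates where x <= l, the second one where x > l.
    This splitting at a level replaces the log-convexity of L^p norms. *)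
Lemma powR_le_interpolate (R : realType) (p eps l x : R) :
  2 <= p -> 0 < eps -> 0 < l -> 0 <= x ->
  x `^ p <= l `^ (p - 2) * x ^+ 2 + l `^ (- eps) * x `^ (p + eps).
Proof.
move=> p2 e0 l0 x0; have [xl|lx] := leP x l.
  rewrite -[leLHS]addr0 lerD ?mulr_ge0 ?powR_ge0//.
  have -> : x `^ p = x `^ (p - 2) * x ^+ 2.
    rewrite -powR_mulrn// -powRD; first by congr powR; lra.
    by apply/implyP => /eqP pe; lra.
  by rewrite ler_wpM2r ?exprn_ge0// ge0_ler_powR ?nnegrE//; lra.
rewrite -[leLHS]add0r lerD ?mulr_ge0 ?powR_ge0 ?exprn_ge0//.
rewrite powRD; last by rewrite (gt_eqF (lt_trans l0 lx)) implybT.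
rewrite mulrCA ler_peMr ?powR_ge0// powRN ler_pdivlMl ?powR_gt0// mulr1.
by rewrite ge0_ler_powR ?nnegrE// ltW.
Qed.

Lemma powR_normB_le (R : realType) (q a c : R) : 0 <= q ->
  `|a - c| `^ q <= 2 `^ q * (`|a| `^ q + `|c| `^ q).
Proof.
move=> q0; pose b := Num.max `|a| `|c|.
have b0 : 0 <= b by rewrite le_max normr_ge0.
apply: (@le_trans _ _ ((2 * b) `^ q)).
  rewrite ge0_ler_powR ?nnegrE ?mulr_ge0// (le_trans (ler_normB _ _))//.
  by rewrite mulr_natl mulr2n lerD// le_max lexx ?orbT.
rewrite powRM// ler_wpM2l ?powR_ge0// /b maxEle.
by case: ifPn => _; rewrite ?lerDl ?lerDr powR_ge0.
Qed.

(** * Integrals against a probability measure *)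

Section probability_integrals.
Local Open Scope ereal_scope.
Context d (T : measurableType d) (R : realType) (mu : probability T R).

(** Jensen's inequality for x |-> |x|^q, read off from Hoelder's inequality
    against the constant function 1, whose norm is 1.  It also holds when f is
    not integrable, because then the right-hand side is infinite; for this
    reason it can be applied to every path, not just to almost every one. *)
Lemma jensen_powR (f : T -> R) (q : R) :
  measurable_fun setT f -> (1 < q)%R ->
  (`|\int[mu]_x f x| `^ q)%:E <= \int[mu]_x (`|f x| `^ q)%:E.
Proof.
move=> mf q1.
have q0 : (0 < q)%R by lra.
have H : \int[mu]_x `|(f x)%:E| <= 'N[mu]_q%:E[EFin \o f].
  have := @hoelder _ _ _ mu f (cst 1)%R q (q / (q - 1))%R mf.
  move=> /(_ (measurable_cst _)) /(_ q0).
  rewrite divr_gt0 ?subr_gt0// => /(_ erefl).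
  have -> : (q^-1 + (q / (q - 1))^-1 = 1)%R.
    by field; rewrite !gt_eqF ?subr_gt0.
  move=> /(_ erefl).
  rewrite Lnorm_cst1 [X in X `^ _](_ : _ = 1); last exact: probability_setT.
  rewrite poweR1r mule1.
  by rewrite Lnorm1 /=; under eq_integral do rewrite mulr1.
have HN : (0 <= fine (\int[mu]_x `|(f x)%:E|))%R.
  by rewrite fine_ge0// integral_ge0.
have E : \int[mu]_x (`|f x| `^ q)%:E = 'N[mu]_q%:E[EFin \o f] `^ q.
  by rewrite poweR_Lnorm ?gt_eqF//.
have [Nfin|] := boolP ('N[mu]_q%:E[EFin \o f] == +oo).
  by rewrite E (eqP Nfin) poweRyr ?gt_eqF ?leey.
rewrite -ltey => Nlty.
have fi : mu.-integrable setT (EFin \o f).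
  apply/integrableP; split; first exact/measurable_EFinP.
  exact: le_lt_trans H Nlty.
rewrite E -(@fineK _ ('N[mu]_q%:E[EFin \o f])); last first.
  by rewrite ge0_fin_numE ?Lnorm_ge0.
rewrite poweR_EFin lee_fin ge0_ler_powR ?nnegrE//.
- exact: ltW.
- by rewrite fine_ge0// Lnorm_ge0.
- rewrite -lee_fin fineK ?ge0_fin_numE ?Lnorm_ge0//.
  rewrite EFin_normr_Rintegral// (le_trans _ H)// le_abse_integral//.
  exact/measurable_EFinP.
Qed.

(** The form in which pointwise inequalities are integrated below; they may fail
    on a null set, which will be that of the non-integrable paths. *)
Lemma ae_le_integral_lin (k f g : T -> R) (a b A B : R) :
  measurable_fun setT k -> measurable_fun setT f -> measurable_fun setT g ->
  (forall x, 0 <= k x)%R -> (forall x, 0 <= f x)%R -> (forall x, 0 <= g x)%R ->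
  (0 <= a)%R -> (0 <= b)%R ->
  {ae mu, forall x, (k x <= a * f x + b * g x)%R} ->
  \int[mu]_x (f x)%:E <= A%:E -> \int[mu]_x (g x)%:E <= B%:E ->
  \int[mu]_x (k x)%:E <= (a * A + b * B)%:E.
Proof.
move=> mk mf mg k0 f0 g0 a0 b0 kfg fA gB.
apply: (@le_trans _ _ (\int[mu]_x (a%:E * (f x)%:E + b%:E * (g x)%:E))).
  apply: ae_ge0_le_integral => //.
  - by move=> x _; rewrite lee_fin.
  - exact/measurable_EFinP.
  - by move=> x _; rewrite adde_ge0// mule_ge0// lee_fin.
  - by apply: emeasurable_funD; apply: measurable_funeM; exact/measurable_EFinP.
  - by apply: filterS kfg => x kx _; rewrite -!EFinM -EFinD lee_fin.
rewrite ge0_integralD//; last 4 first.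
- by move=> x _; rewrite mule_ge0// lee_fin.
- by apply: measurable_funeM; exact/measurable_EFinP.
- by move=> x _; rewrite mule_ge0// lee_fin.
- by apply: measurable_funeM; exact/measurable_EFinP.
rewrite !ge0_integralZl//;
  try by [exact/measurable_EFinP|move=> x _; rewrite lee_fin].
by rewrite EFinD !EFinM leeD// lee_wpmul2l.
Qed.

Lemma sqr_Rintegral_le (f : T -> R) (C : R) :
  measurable_fun setT f -> \int[mu]_x (f x ^+ 2)%:E <= C%:E ->
  ((\int[mu]_x f x) ^+ 2 <= C)%R.
Proof.
move=> mf fC.
rewrite -lee_fin -powR_norm2 (le_trans _ fC)//.
under eq_integral do rewrite -powR_norm2.
by apply: jensen_powR => //; lra.
Qed.

Lemma integral_le_cst (f : T -> \bar R) (C : R) :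
  measurable_fun setT f -> (forall x, 0 <= f x) -> (forall x, f x <= C%:E) ->
  \int[mu]_x f x <= C%:E.
Proof.
move=> mf f0 fC.
have -> : C%:E = \int[mu]_x (cst C%:E) x.
  by rewrite integral_cst//= probability_setT mule1.
exact: ge0_le_integral.
Qed.

(** Domination by f^2 + g^2. *)
Lemma integrable_mul_of_sqr (f g : T -> R) (C C' : R) :
  measurable_fun setT f -> measurable_fun setT g ->
  \int[mu]_x (f x ^+ 2)%:E <= C%:E -> \int[mu]_x (g x ^+ 2)%:E <= C'%:E ->
  mu.-integrable setT (fun x => (f x * g x)%:E).
Proof.
move=> mf mg fC gC.
have sq (k : T -> R) (K : R) : measurable_fun setT k ->
    \int[mu]_x (k x ^+ 2)%:E <= K%:E ->
    mu.-integrable setT (fun x => (k x ^+ 2)%:E).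
  move=> mk kK; apply/integrableP; split.
    by apply/measurable_EFinP; exact: measurable_funX.
  under eq_integral do rewrite gee0_abs ?lee_fin ?sqr_ge0//.
  by rewrite (le_lt_trans kK)// ltry.
apply: le_integrable (integrableD _ (sq _ _ mf fC) (sq _ _ mg gC)) => //.
  by apply/measurable_EFinP; exact: measurable_funM.
move=> x _ /=; rewrite lee_fin [leRHS]ger0_norm ?addr_ge0 ?sqr_ge0//.
by rewrite ler_norml; apply/andP; split; nra.
Qed.

Lemma integrable_of_sqr (f : T -> R) (C : R) :
  measurable_fun setT f -> \int[mu]_x (f x ^+ 2)%:E <= C%:E ->
  mu.-integrable setT (EFin \o f).
Proof.
move=> mf fC; apply: (eq_integrable _ (fun x => (f x * cst 1 x)%:E)) => //.
  by move=> x _ /=; rewrite mulr1.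
apply: (integrable_mul_of_sqr (C' := 1) mf _ fC) => //.
rewrite /cst expr1n.
by rewrite integral_cst//= probability_setT mule1.
Qed.

End probability_integrals.

(** * Averages of a random function over a time law *)

Section random_average.
Local Open Scope ereal_scope.
Context d1 d2 (T : measurableType d1) (Om : measurableType d2) (R : realType).
Variables (nu : probability T R) (P : probability Om R).

Definition average (h : T * Om -> R) (w : Om) : R := (\int[nu]_s h (s, w))%R.

(** Tonelli's theorem for the positive and the negative part gives measurability
    whether or not the sections are integrable. *)
Lemma measurable_integral_fst (f : T * Om -> \bar R) : measurable_fun setT f ->
  measurable_fun setT (fun w => \int[nu]_s f (s, w)).
Proof.
move=> mf.
rewrite (_ : (fun _ => _) = (fun w => \int[nu]_s f^\+ (s, w)) \-
                            (fun w => \int[nu]_s f^\- (s, w))).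
  apply: emeasurable_funB.
    apply: (@measurable_fun_fubini_tonelli_G _ _ _ _ _ nu f^\+) => //.
    exact: measurable_funepos.
  apply: (@measurable_fun_fubini_tonelli_G _ _ _ _ _ nu f^\-) => //.
  exact: measurable_funeneg.
apply/funext => w; rewrite [LHS]integralE.
under eq_integral do rewrite funepos_comp/=.
by under [X in _ - X = _]eq_integral do rewrite funeneg_comp/=.
Qed.

Lemma measurable_integral_snd (f : T * Om -> \bar R) : measurable_fun setT f ->
  measurable_fun setT (fun s => \int[P]_w f (s, w)).
Proof.
move=> mf.
rewrite (_ : (fun _ => _) = (fun s => \int[P]_w f^\+ (s, w)) \-
                            (fun s => \int[P]_w f^\- (s, w))).
  apply: emeasurable_funB.
    apply: (@measurable_fun_fubini_tonelli_F _ _ _ _ _ P f^\+) => //.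
    exact: measurable_funepos.
  apply: (@measurable_fun_fubini_tonelli_F _ _ _ _ _ P f^\-) => //.
  exact: measurable_funeneg.
apply/funext => w; rewrite [LHS]integralE.
under eq_integral do rewrite funepos_comp/=.
by under [X in _ - X = _]eq_integral do rewrite funeneg_comp/=.
Qed.

Variables (h : T * Om -> R).
Hypothesis mh : measurable_fun setT h.

Lemma measurable_average : measurable_fun setT (average h).
Proof.
apply: measurableT_comp; first exact: fine_measurable.
by apply: (@measurable_integral_fst (EFin \o h)); exact/measurable_EFinP.
Qed.

(** Jensen's inequality on each path, then Tonelli's theorem. *)
Lemma average_moment_le (q K : R) : (1 < q)%R ->
  (forall s, \int[P]_w (`|h (s, w)| `^ q)%:E <= K%:E) ->
  \int[P]_w (`|average h w| `^ q)%:E <= K%:E.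
Proof.
move=> q1 hK.
have mhq : measurable_fun setT (fun z => (`|h z| `^ q)%:E).
  by apply/measurable_EFinP; apply: (measurableT_comp (measurable_powR q));
    exact: measurableT_comp.
apply: (@le_trans _ _ (\int[P]_w \int[nu]_s (`|h (s, w)| `^ q)%:E)).
  apply: ge0_le_integral => //.
  - apply/measurable_EFinP; apply: (measurableT_comp (measurable_powR q)).
    by apply: measurableT_comp => //; exact: measurable_average.
  - exact: (@measurable_integral_fst (fun z => (`|h z| `^ q)%:E)).
  - by move=> w _; apply: jensen_powR => //; exact: measurable_fun_pair1.
rewrite -(@fubini_tonelli _ _ _ _ _ nu P (fun z => (`|h z| `^ q)%:E))//.
apply: integral_le_cst => //.
- exact: (@measurable_integral_snd (fun z => (`|h z| `^ q)%:E)).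
- by move=> s; apply: integral_ge0 => w _; rewrite lee_fin powR_ge0.
Qed.

Variable C : R.
Hypothesis hC : forall s, \int[P]_w (h (s, w) ^+ 2)%:E <= C%:E.

Lemma integral_sqr_prod_le : \int[nu \x P]_z (h z ^+ 2)%:E <= C%:E.
Proof.
have mh2 : measurable_fun setT (fun z => (h z ^+ 2)%:E).
  by apply/measurable_EFinP; exact: measurable_funX.
rewrite fubini_tonelli1//; last by move=> z; rewrite lee_fin sqr_ge0.
apply: integral_le_cst => //.
- exact: (@measurable_integral_snd (fun z => (h z ^+ 2)%:E)).
- by move=> s; apply: integral_ge0 => w _; rewrite lee_fin sqr_ge0.
Qed.

Lemma average_sqr_le : \int[P]_w (average h w ^+ 2)%:E <= C%:E.
Proof.
under eq_integral do rewrite -powR_norm2.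
apply: average_moment_le => [|s]; first lra.
by under eq_integral do rewrite powR_norm2.
Qed.

Lemma ae_integrable_path :
  {ae P, forall w, nu.-integrable setT (fun s => (h (s, w))%:E)}.
Proof.
apply: (@ae_integrable2 _ _ _ _ _ nu P (EFin \o h)).
exact: integrable_of_sqr mh integral_sqr_prod_le.
Qed.

Lemma integrable_prod_mul (k : Om -> R) (C' : R) :
  measurable_fun setT k -> \int[P]_w (k w ^+ 2)%:E <= C'%:E ->
  (nu \x P).-integrable setT (fun z => (h z * k z.2)%:E).
Proof.
move=> mk kC.
have mk2 : measurable_fun setT (fun z : T * Om => k z.2).
  exact: measurableT_comp.
apply: (integrable_mul_of_sqr mh mk2 integral_sqr_prod_le (C' := C')).
rewrite fubini_tonelli1//.
- by rewrite /fubini_F /= integral_cst//= probability_setT mule1.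
- by apply/measurable_EFinP; exact: measurable_funX.
- by move=> z; rewrite lee_fin sqr_ge0.
Qed.

(** Fubini's theorem, after which the factor k leaves the inner integral
    wherever the path is integrable. *)
Lemma integral_average_mul (k : Om -> R) (C' : R) :
  measurable_fun setT k -> \int[P]_w (k w ^+ 2)%:E <= C'%:E ->
  \int[nu]_s \int[P]_w (h (s, w) * k w)%:E = \int[P]_w (average h w * k w)%:E.
Proof.
move=> mk kC; have ihk := integrable_prod_mul mk kC.
rewrite (Fubini ihk)/=.
apply: ae_eq_integral => //.
- exact: (@measurable_integral_fst (fun z => (h z * k z.2)%:E)
    (measurable_int _ ihk)).
- apply/measurable_EFinP; apply: measurable_funM => //.
  exact: measurable_average.
apply: filterS ae_integrable_path => w iw _.
under eq_integral do rewrite EFinM.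
by rewrite integralZr// /average EFinM /Rintegral fineK// integrable_fin_num.
Qed.

(** The square of the average is a double integral over pairs of times; it is
    reached by [integral_average_mul], first with k = h(s, .) for fixed s and
    then with k the average itself. *)
Lemma double_integral_mul :
  \int[nu]_s \int[nu]_u \int[P]_w (h (s, w) * h (u, w))%:E =
  \int[P]_w (average h w ^+ 2)%:E.
Proof.
transitivity (\int[nu]_s \int[P]_w (h (s, w) * average h w)%:E).
  apply: eq_integral => s _.
  under eq_integral do under eq_integral do rewrite mulrC.
  rewrite (@integral_average_mul (fun w => h (s, w)) C)//; last first.
    exact: measurable_fun_pair2.
  by under eq_integral do rewrite mulrC.
by rewrite (integral_average_mul measurable_average average_sqr_le).
Qed.

End random_average.

(** * Mean square error of the average *)

Section mean_square.
Local Open Scope ereal_scope.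
Context d1 d2 (T : measurableType d1) (Om : measurableType d2) (R : realType).
Variables (nu : probability T R) (P : probability Om R).
Variables (X : T * Om -> R) (M : R).
Hypothesis mX : measurable_fun setT X.
Hypothesis XM : forall s, \int[P]_w (X (s, w) ^+ 2)%:E <= M%:E.

Let e s : R := (\int[P]_w X (s, w))%R.
Let h z := (X z - e z.1)%R.

Let me : measurable_fun setT e.
Proof.
apply: measurableT_comp; first exact: fine_measurable.
apply: (@measurable_integral_snd _ _ _ _ _ P (EFin \o X)).
exact/measurable_EFinP.
Qed.

Let mh : measurable_fun setT h.
Proof. by apply: measurable_funB => //; exact: measurableT_comp. Qed.

Let eM s : (e s ^+ 2 <= M)%R.
Proof. by apply: sqr_Rintegral_le => //; exact: measurable_fun_pair2. Qed.

Let e2M : \int[nu]_s (e s ^+ 2)%:E <= M%:E.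
Proof.
apply: integral_le_cst => [|s|s]; rewrite ?lee_fin ?sqr_ge0//.
by apply/measurable_EFinP; exact: measurable_funX.
Qed.

Let expectation_e s : 'E_P[fun w => X (s, w)] = (e s)%:E.
Proof.
rewrite unlock /e /Rintegral fineK// integrable_fin_num//.
by apply: (integrable_of_sqr _ (XM s)); exact: measurable_fun_pair2.
Qed.

Let ie : nu.-integrable setT (EFin \o e).
Proof. exact: integrable_of_sqr me e2M. Qed.

(** The second moment bound passes from X to its means e(s), and from these to
    their average, by Jensen's inequality. *)
Lemma mean_average :
  exists2 a : R, \int[nu]_s 'E_P[fun w => X (s, w)] = a%:E & (a ^+ 2 <= M)%R.
Proof.
exists (\int[nu]_s e s)%R; last exact: sqr_Rintegral_le.
rewrite /Rintegral fineK ?integrable_fin_num//.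
by apply: eq_integral => s _; rewrite expectation_e.
Qed.

Let hM s : \int[P]_w (h (s, w) ^+ 2)%:E <= (2 * M + 2 * M)%:E.
Proof.
apply: (@ae_le_integral_lin _ _ _ P _ (fun w => X (s, w) ^+ 2)%R
    (cst (e s ^+ 2)%R)) => //.
- by apply: measurable_funX; exact: measurable_fun_pair2.
- by apply: measurable_funX; exact: measurable_fun_pair2.
- by move=> x; exact: sqr_ge0.
- by move=> x; exact: sqr_ge0.
- by move=> x; exact: sqr_ge0.
- by apply: aeW => w; exact: sqrB_le.
- by apply: integral_le_cst => [|w|w]; rewrite ?lee_fin /cst ?sqr_ge0 ?eM.
Qed.

(* [fine] in the definition of the covariance is harmless, since the means are
   finite (expectation_e). *)
Let covE s u : covariance P (fun w => X (s, w)) (fun w => X (u, w)) =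
  \int[P]_w (h (s, w) * h (u, w))%:E.
Proof. by rewrite unlock !expectation_e unlock. Qed.

Lemma measurable_covariance s : measurable_fun setT
  (fun u => covariance P (fun w => X (s, w)) (fun w => X (u, w))).
Proof.
under eq_fun do rewrite covE.
apply: (@measurable_integral_snd _ _ _ _ _ P
  (fun z => (h (s, z.2) * h z)%:E)) => //.
apply/measurable_EFinP; apply: measurable_funM => //.
by apply: (measurableT_comp (measurable_fun_pair2 s mh)).
Qed.

(** Since the inner integral equals E[h(s, .) G] with G the average of h,
    integrability is that of h(s, w) G(w) on the product. *)
Lemma integrable_integral_covariance : nu.-integrable setT
  (fun s => \int[nu]_u covariance P (fun w => X (s, w)) (fun w => X (u, w))).
Proof.
rewrite (_ : (fun _ => _) =
    fun s => \int[P]_w (h (s, w) * average nu h w)%:E); last first.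
  apply/funext => s; under [RHS]eq_integral do rewrite mulrC.
  rewrite -(integral_average_mul nu mh hM _ (hM s)).
    apply: eq_integral => u _; rewrite covE.
    by under eq_integral do rewrite mulrC.
  exact: measurable_fun_pair2.
have ih := integrable_prod_mul nu mh hM
  (measurable_average nu mh) (average_sqr_le nu mh hM).
exact: integrable_fubini_F ih.
Qed.

(** The bias-variance decomposition, up to a factor 2 that spares proving that
    the average of h is centred. *)
Lemma mean_square_le (c delta r : R) :
  \int[nu]_s \int[nu]_u
    covariance P (fun w => X (s, w)) (fun w => X (u, w)) <= delta%:E ->
  `| \int[nu]_s 'E_P[fun w => X (s, w)] - c%:E | <= r%:E ->
  \int[P]_w (`|average nu X w - c| ^+ 2)%:E <= (2 * delta + 2 * r ^+ 2)%:E.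
Proof.
move=> covd meanr.
have avgh : \int[P]_w (average nu h w ^+ 2)%:E <= delta%:E.
  rewrite -(double_integral_mul nu mh hM) (le_trans _ covd)//.
  rewrite le_eqVlt; apply/orP; left; apply/eqP.
  by apply: eq_integral => s _; apply: eq_integral => u _.
have er : ((\int[nu]_s e s - c) ^+ 2 <= r ^+ 2)%R.
  move: meanr; under eq_integral do rewrite expectation_e.
  rewrite -(@fineK _ (\int[nu]_s (e s)%:E)) ?integrable_fin_num//.
  rewrite -EFinB /= lee_fin => H.
  rewrite -[leLHS]real_normK ?num_real//.
  by rewrite lerXn2r ?nnegrE ?normr_ge0// (le_trans _ H).
apply: (@ae_le_integral_lin _ _ _ P _ (fun w => average nu h w ^+ 2)%R
    (cst ((\int[nu]_s e s - c) ^+ 2)%R)) => //.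
- apply: measurable_funX; apply: measurableT_comp => //.
  by apply: measurable_funB => //; exact: measurable_average.
- by apply: measurable_funX; exact: measurable_average.
- by move=> x; exact: sqr_ge0.
- by move=> x; exact: sqr_ge0.
- have := ae_integrable_path nu mX XM; apply: filterS => w iw.
  (* On an integrable path the average of h is that of X minus that of e. *)
  have -> : average nu h w = (average nu X w - \int[nu]_s e s)%R.
    exact: (RintegralB measurableT iw ie).
  set a := average nu X w; set b := (\int[nu]_s e s)%R.
  rewrite real_normK ?num_real//.
  have := sqrB_le (a - b) (c - b).
  by rewrite opprB addrA subrK -(opprB b c) sqrrN.
- by apply: integral_le_cst => [|w|w]; rewrite ?lee_fin /cst ?sqr_ge0.
Qed.

End mean_square.

(** * The uniform law on the times before a horizon *)

(** Holds for all nonnegative a and b, even when both are infinite. *)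
Lemma gt0_muleBr (R : realDomainType) (k : R) (a b : \bar R) : 0 < k ->
  (0 <= a -> 0 <= b -> k%:E * (a - b) = k%:E * a - k%:E * b)%E.
Proof.
move=> k0; have k1 : (0 < k%:E)%E by rewrite lte_fin.
move: a b => [a| |] [b| |] // _ _.
- by rewrite -EFinB -!EFinM -EFinB mulrBr.
- by rewrite addeNy gt0_muleNy// gt0_muley.
- by rewrite addye// gt0_muley.
- by rewrite addeNy gt0_muleNy// gt0_muley.
Qed.

Section uniform_law.
Local Open Scope ereal_scope.
Context d (T : measurableType d) (R : realType).
Variables (mu : {measure set T -> \bar R}) (D : set T) (mD : measurable D).
Variable t : R.
Hypotheses (t0 : (0 < t)%R) (muD : mu D = t%:E).

(** [point] only fills the case where D has mass 0 or infinite mass, which is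
    excluded by muD. *)
Definition uniform_law : probability T R := mnormalize (mrestr mu mD) point.

Lemma uniform_lawE (A : set T) : uniform_law A = (t^-1)%:E * mu (A `&` D).
Proof.
have E : mrestr mu mD setT = t%:E by rewrite /mrestr setTI.
by rewrite /uniform_law /= /mnormalize /= E eqe (gt_eqF t0)/= muleC.
Qed.

Let ge0_integral_uniform_law (f : T -> \bar R) :
  measurable_fun setT f -> (forall x, 0 <= f x) ->
  \int[uniform_law]_x f x = (t^-1)%:E * \int[mu]_(x in D) f x.
Proof.
move=> mf f0.
have t1 : (0 <= t^-1)%R by rewrite invr_ge0 ltW.
rewrite (@ge0_negligible_integral _ _ _ uniform_law setT (~` D))//;
  last 2 first.
- exact: measurableC.
- rewrite [LHS]uniform_lawE.
  by rewrite setICl measure0 mule0.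
rewrite setTD setCK.
rewrite (@eq_measure_integral _ _ _ _ (mscale (NngNum t1) mu)).
  rewrite ge0_integral_mscale//.
  exact: measurable_funTS.
by move=> A mA AD; rewrite [LHS]uniform_lawE (setIidl AD).
Qed.

(** The identity survives when the integral is infinite, and even when it is
    oo - oo; it can thus be used path by path, without discarding a null set. *)
Lemma integral_uniform_law (f : T -> \bar R) : measurable_fun setT f ->
  \int[uniform_law]_x f x = (t^-1)%:E * \int[mu]_(x in D) f x.
Proof.
move=> mf; rewrite [LHS]integralE [in RHS](integralE mu D f).
rewrite !ge0_integral_uniform_law//.
- have t1 : (0 < t^-1)%R by rewrite invr_gt0.
  by apply/esym/(gt0_muleBr t1); apply: integral_ge0.
- exact: measurable_funeneg.
- exact: measurable_funepos.
Qed.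

End uniform_law.

(** In discrete time the horizon is itself an integer n, and 0, ..., n - 1 are
    n points. *)
Lemma time_setting_before (R : realType) (T : set (measurableTypeR R))
    (tau : {measure set (measurableTypeR R) -> \bar R}) (t : R) :
  time_setting T tau -> T t ->
  [/\ measurable (before T t), measurable T & tau (before T t) = t%:E].
Proof.
case=> -[-> ->] Tt.
  have E : before [set s : R | 0 <= s] t = `[0, t[%classic.
    rewrite /before setIidr// => s /=; rewrite in_itv/= => /andP[]//.
  rewrite E; split.
  - exact: measurable_itv.
  - rewrite (_ : [set s | _] = `[0, +oo[%classic); first exact: measurable_itv.
    by apply/seteqP; split => s /=; rewrite in_itv/= andbT.
  - rewrite [LHS](lebesgue_measure_itv `[0, t[)/= lte_fin; case: ltP => [_|t0].
      by rewrite oppr0 adde0.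
    by congr EFin; apply/eqP; rewrite eq_le t0 Tt.
case: Tt => n _ <-.
have E : before (range (fun n : nat => n%:R : R)) n%:R =
    [set (k%:R : R) | k in `I_n].
  apply/seteqP; split=> [_ /= [[k _ <-]]|_ [k kn <-]].
    by rewrite /= in_itv/= ltr_nat => /andP[_ kn]; exists k.
  by split; [exists k|rewrite /= in_itv/= ltr_nat kn ler0n].
have mN (A : set nat) :
    measurable ([set (k%:R : R) | k in A] : set (measurableTypeR R)).
  apply: countable_measurable => //.
  by apply: sub_countable (card_image_le _ _) _; exact: countableP.
rewrite E; split => //.
rewrite /= /counting asboolT; last exact: finite_image.
rewrite (@card_fset_set _ _ n)//.
apply: inj_card_eq => // x y _ _ /eqP; rewrite eqr_nat => /eqP//.
Qed.

(** * Time averages at a fixed horizon *)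

Section fixed_horizon.
Local Open Scope ereal_scope.
Context (R : realType) (T : set (measurableTypeR R))
  (tau : {measure set (measurableTypeR R) -> \bar R})
  d (Omega : measurableType d) (P : probability Omega R)
  (Y : R -> Omega -> R) (M t : R).
Hypothesis Ttau : time_setting T tau.
Hypothesis mY : measurable_process T Y.
Hypothesis YM : forall s, T s -> 'E_P[fun w => (`|Y s w| ^+ 2)%R] <= M%:E.
Hypotheses (Tt : T t) (t0 : (0 < t)%R).

Let D := before T t.
Let DT s : D s -> T s. Proof. by case. Qed.
Let mD : measurable D.
Proof. by have [] := time_setting_before Ttau Tt. Qed.
Let tauD : tau D = t%:E.
Proof. by have [] := time_setting_before Ttau Tt. Qed.
Let nu := uniform_law tau mD.

(* The process is only known to be measurable on T, hence the extension by 0 off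
   D; nu does not charge that part. *)
Let X : measurableTypeR R * Omega -> R :=
  (fun z : measurableTypeR R * Omega => Y z.1 z.2) \_ (D `*` [set: Omega]).

Let mX : measurable_fun setT X.
Proof.
apply/(measurable_restrictT _ (measurableX mD measurableT)).
apply: measurable_funS mY => [|z /= [Dz _]]; last by split => //; exact: DT.
by have [_ mT _] := time_setting_before Ttau Tt; exact: measurableX.
Qed.

Let X_in s : D s -> (fun w => X (s, w)) = Y s.
Proof.
move=> Ds; apply/funext => w; rewrite /X patchE ifT//.
by rewrite inE; split.
Qed.

Let X_out s : ~ D s -> (fun w => X (s, w)) = cst 0%R.
Proof.
move=> Ds; apply/funext => w; rewrite /X patchE ifF//.
by apply/negbTE; rewrite notin_setE => -[].
Qed.

Let moment_X q K : (1 < q)%R ->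
  (forall s, T s -> 'E_P[fun w => (`|Y s w| `^ q)%R] <= K%:E) ->
  forall s, \int[P]_w (`|X (s, w)| `^ q)%:E <= K%:E.
Proof.
move=> q1 YK s; have [Ds|Ds] := pselect (D s).
  have := YK _ (DT Ds); rewrite unlock -(X_in Ds); apply: le_trans.
  by [].
under eq_integral => w _.
  rewrite (_ : X (s, w) = 0%R); last by have := X_out Ds => /(congr1 (@^~ w)).
  rewrite normr0 powR0; last lra.
  over.
rewrite integral0; apply: le_trans (YK _ Tt).
by rewrite unlock; apply: integral_ge0 => w _; rewrite lee_fin powR_ge0.
Qed.

Let XM s : \int[P]_w (X (s, w) ^+ 2)%:E <= M%:E.
Proof.
under eq_integral do rewrite -powR_norm2.
apply: moment_X => [|{}s Ts]; first lra.
apply: le_trans (YM Ts); rewrite unlock.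
by under eq_integral do rewrite powR_mulrn//.
Qed.

(** This holds on every path: if the integral is infinite, both sides are 0. *)
Lemma time_average_uniform_law : time_average T tau Y t = average nu X.
Proof.
apply/funext => w; rewrite /time_average /average /Rintegral.
rewrite (integral_uniform_law mD t0 tauD); last first.
  apply/measurable_EFinP.
  exact: measurable_fun_pair1.
rewrite [X in _ = fine (_ * X)](_ : _ = \int[tau]_(s in D) (Y s w)%:E).
  case: (\int[tau]_(s in D) (Y s w)%:E) => [r| |] //=.
  - by rewrite gt0_muley ?lte_fin ?invr_gt0//= mulr0.
  - by rewrite gt0_muleNy ?lte_fin ?invr_gt0//= mulr0.
by apply: eq_integral => s /set_mem Ds; rewrite -(X_in Ds).
Qed.

Let mean_uniform_law :
  (t^-1)%:E * \int[tau]_(s in D) 'E_P[Y s] = \int[nu]_s 'E_P[fun w => X (s, w)].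
Proof.
rewrite (integral_uniform_law mD t0 tauD); last first.
  rewrite unlock; apply: (@measurable_integral_snd _ _ _ _ _ P (EFin \o X)).
  exact/measurable_EFinP.
by congr (_ * _); apply: eq_integral => s /set_mem Ds; rewrite (X_in Ds).
Qed.

Let cov_uniform_law :
  ((t ^+ 2)^-1)%:E * \int[tau]_(s in D) \int[tau]_(u in D)
     covariance P (Y s) (Y u) =
  \int[nu]_s \int[nu]_u covariance P (fun w => X (s, w)) (fun w => X (u, w)).
Proof.
(* The factor t = t^2 / t has to be pulled out of the outer integral, which is
   where integrability of the inner one comes in. *)
have iJ := integrable_integral_covariance nu mX XM.
set J := (fun s => \int[nu]_u _) in iJ.
rewrite [RHS](_ : _ = \int[nu]_s J s)//.
have -> : \int[tau]_(s in D) \int[tau]_(u in D) covariance P (Y s) (Y u) =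
    \int[tau]_(s in D) (t%:E * J s).
  apply: eq_integral => s /set_mem Ds; rewrite /J.
  rewrite (integral_uniform_law mD t0 tauD); last first.
    exact: measurable_covariance mX XM s.
  rewrite muleA -EFinM divff ?gt_eqF// mul1e.
  by apply: eq_integral => u /set_mem Du; rewrite !X_in.
rewrite expr2 invfM EFinM -muleA -(integral_uniform_law mD t0 tauD); last first.
  by apply: measurable_funeM; exact: measurable_int iJ.
by rewrite integralZl// muleA -EFinM mulVf ?gt_eqF// mul1e.
Qed.

Lemma time_average_mean_square (c delta r : R) :
  ((t ^+ 2)^-1)%:E * \int[tau]_(s in D) \int[tau]_(u in D)
     covariance P (Y s) (Y u) <= delta%:E ->
  `| (t^-1)%:E * \int[tau]_(s in D) 'E_P[Y s] - c%:E | <= r%:E ->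
  'E_P[fun w => (`|time_average T tau Y t w - c| ^+ 2)%R] <=
    (2 * delta + 2 * r ^+ 2)%:E.
Proof.
rewrite cov_uniform_law mean_uniform_law time_average_uniform_law => covd meanr.
by rewrite unlock; exact: mean_square_le XM _ _ _ covd meanr.
Qed.

(** The averaged mean a satisfies a^2 <= M, whence |a| <= 1 + M. *)
Lemma mean_limit_le (c r : R) :
  `| (t^-1)%:E * \int[tau]_(s in D) 'E_P[Y s] - c%:E | <= r%:E ->
  (`|c| <= r + (1 + M))%R.
Proof.
rewrite mean_uniform_law; have [a -> aM] := mean_average nu mX XM.
rewrite -EFinB /= lee_fin => ac.
have : (`|a| <= 1 + M)%R.
  by rewrite ler_norml; apply/andP; split; nra.
have := ler_distD a c 0%R; rewrite !subr0 distrC; lra.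
Qed.

Lemma time_average_moment (q K : R) : (1 < q)%R ->
  (forall s, T s -> 'E_P[fun w => (`|Y s w| `^ q)%R] <= K%:E) ->
  'E_P[fun w => (`|time_average T tau Y t w| `^ q)%R] <= K%:E.
Proof.
move=> q1 YK; rewrite time_average_uniform_law unlock.
by apply: average_moment_le => //; exact: moment_X.
Qed.

Lemma measurable_time_average : measurable_fun setT (time_average T tau Y t).
Proof. by rewrite time_average_uniform_law; exact: measurable_average. Qed.

End fixed_horizon.

(** * Moments of a single random variable *)

Section Lp_bounds.
Context d (T : measurableType d) (R : realType) (mu : probability T R).
Variable f : T -> R.
Hypothesis mf : measurable_fun setT f.

Let mpow (g : T -> R) p : measurable_fun setT g ->
  measurable_fun setT (fun x => `|g x| `^ p).
Proof.
move=> mg; apply: (measurableT_comp (measurable_powR p)).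
exact: measurableT_comp.
Qed.

Lemma moment_shift_le (q K B c : R) : 0 <= q -> `|c| <= B ->
  ('E_mu[fun x => (`|f x| `^ q)%R] <= K%:E ->
   'E_mu[fun x => (`|f x - c| `^ q)%R] <= (2 `^ q * K + 2 `^ q * B `^ q)%:E)%E.
Proof.
move=> q0 cB; rewrite unlock => fK.
apply: (@ae_le_integral_lin _ _ _ mu _ (fun x => `|f x| `^ q)
    (cst (B `^ q))) => //;
  try by [move=> x; exact: powR_ge0|exact: powR_ge0].
- by apply: mpow; exact: measurable_funB.
- exact: mpow.
- apply: aeW => x; rewrite -mulrDr (le_trans (powR_normB_le _ _ q0))//.
  rewrite ler_wpM2l ?powR_ge0// lerD2l ge0_ler_powR ?nnegrE//.
  exact: le_trans cB.
- by apply: integral_le_cst => [|x|x]; rewrite ?lee_fin /cst ?powR_ge0.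
Qed.

Lemma moment_interpolation (p eps l A C : R) : 2 <= p -> 0 < eps -> 0 < l ->
  ('E_mu[fun x => (`|f x| ^+ 2)%R] <= A%:E ->
   'E_mu[fun x => (`|f x| `^ (p + eps))%R] <= C%:E ->
   'E_mu[fun x => (`|f x| `^ p)%R] <=
     (l `^ (p - 2) * A + l `^ (- eps) * C)%:E)%E.
Proof.
move=> p2 e0 l0; rewrite unlock => fA fC.
apply: (ae_le_integral_lin _ _ _ _ _ _ _ _ _ fA fC) => //;
  try by [move=> x; exact: powR_ge0|exact: powR_ge0].
- exact: mpow.
- by apply: measurable_funX; exact: measurableT_comp.
- exact: mpow.
- by apply: aeW => x; exact: powR_le_interpolate.
Qed.

End Lp_bounds.

(** * Uniform limits *)

Lemma tends_to_0P (R : realType) (T : set R) (f : R -> \bar R) :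
  tends_to_0 T f <->
  forall e : R, 0 < e -> exists N : R, forall t, T t -> N < t ->
    (`|f t| < e%:E)%E.
Proof.
split=> [f0 e e0|f0 A A0].
  have : nbhs (0%E : \bar R) [set x : \bar R | (`|x| < e%:E)%E].
    exists e => //= r; rewrite /ball_/= sub0r normrN lte_fin//.
  by move=> /f0[N [_ fN]]; exists N => t Tt Nt; exact: fN.
move: A0 => [e /= e0 eA]; have [N fN] := f0 e e0.
exists N; split; first exact: num_real.
move=> t Nt Tt; have := fN t Tt Nt.
case E : (f t) => [r| |]//=; rewrite lte_fin => re; rewrite E.
by apply: eA; rewrite /ball_/= sub0r normrN.
Qed.

Section uniform_suprema.
Context (R : realType) (I : Type).
Implicit Types (F : I -> \bar R) (e b : R).
Local Open Scope ereal_scope.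

(** The index type must be inhabited: the supremum over the empty family is
    -oo, whose absolute value is infinite. *)
Lemma ereal_sup_range_lt F b e : inhabited I ->
  (forall i, 0 <= F i <= b%:E) -> (b < e)%R ->
  `|ereal_sup (range F)| < e%:E.
Proof.
move=> [i0] Fb be; rewrite gee0_abs; last first.
  have /andP[F0 _] := Fb i0; apply: le_trans F0 _.
  by apply: ereal_sup_ubound; exists i0.
apply: (@le_lt_trans _ _ b%:E); last by rewrite lte_fin.
by apply: ge_ereal_sup => _ [i _ <-]; have /andP[] := Fb i.
Qed.

Lemma le_of_ereal_sup_range_lt F e :
  `|ereal_sup (range F)| < e%:E -> forall i, F i <= e%:E.
Proof.
move=> Fe i; apply: le_trans (ltW Fe); apply: le_trans (lee_abs _).
by apply: ereal_sup_ubound; exists i.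
Qed.

Lemma uniform_bound_of_ereal_sup (S : Type) (T : set S) (F : I -> S -> \bar R) :
  ereal_sup (range (fun i => ereal_sup [set F i t | t in T])) < +oo ->
  exists2 M : R, (0 <= M)%R & forall i t, T t -> F i t <= M%:E.
Proof.
set s := ereal_sup _ => soo.
have Fs i t : T t -> F i t <= s.
  move=> Tt; apply: (@le_trans _ _ (ereal_sup [set F i t | t in T])).
    by apply: ereal_sup_ubound; exists t.
  by apply: ereal_sup_ubound; exists i.
case: s soo Fs => [r| |]// _ Fs; last first.
  by exists 0%R => // i t Tt; rewrite (le_trans (Fs i t Tt))// leNye.
exists `|r|%R => // i t Tt; apply: le_trans (Fs i t Tt) _.
by rewrite lee_fin ler_norm.
Qed.

End uniform_suprema.

Theorem theorem3p1 (R : realType)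
    (T : set (measurableTypeR R))
    (tau : {measure set (measurableTypeR R) -> \bar R})
    (d : nat) (Theta : set 'rV[R]_d)
    (disp : measure_display) (Omega : measurableType disp)
    (P : Theta -> probability Omega R)
    (Y : R -> Omega -> R) (m : Theta -> R) :
  time_setting T tau ->
  measurable_process T Y ->
  (ereal_sup (range (fun theta : Theta =>
     ereal_sup [set 'E_(P theta)[fun w => (`|Y t w| ^+ 2)%R] | t in T])) < +oo)%E ->
  tends_to_0 T (fun t => ereal_sup (range (fun theta : Theta =>
    (`| (t^-1)%R%:E * \int[tau]_(s in before T t) 'E_(P theta)[Y s]
       - (m theta)%:E |)%E))) ->
  tends_to_0 T (fun t => ereal_sup (range (fun theta : Theta =>
    (((t ^+ 2)^-1)%R%:E * \int[tau]_(s in before T t) \int[tau]_(u in before T t)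
       covariance (P theta) (Y s) (Y u))%E))) ->
  tends_to_0 T (fun t => ereal_sup (range (fun theta : Theta =>
    'E_(P theta)[fun w => (`|time_average T tau Y t w - m theta| ^+ 2)%R]%E)))
  /\
  forall p eps : R, 2 <= p -> 0 < eps ->
    (ereal_sup (range (fun theta : Theta =>
       ereal_sup [set 'E_(P theta)[fun w => (`|Y t w| `^ (p + eps))%R]
                 | t in T])) < +oo)%E ->
    tends_to_0 T (fun t => ereal_sup (range (fun theta : Theta =>
      'E_(P theta)[fun w => (`|time_average T tau Y t w - m theta| `^ p)%R]%E))).
Proof.
move=> Ttau mY /uniform_bound_of_ereal_sup[M M0 YM] meanP covP.
(* Over an empty parameter set all suprema are -oo, so that the conclusions
   are the hypothesis itself. *)
have [[theta0]|noTheta] := pselect (inhabited Theta); last first.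
  have E (F G : R -> Theta -> \bar R) :
      tends_to_0 T (fun t => ereal_sup (range (F t))) ->
      tends_to_0 T (fun t => ereal_sup (range (G t))).
    rewrite (_ : F = G)//; apply/funext => t; apply/funext => i.
    by exfalso; apply: noTheta; split.
  by split; [exact: E meanP|move=> *; exact: E meanP].
have inh : inhabited Theta by split.
move/tends_to_0P in meanP; move/tends_to_0P in covP.
have L2 : tends_to_0 T (fun t => ereal_sup (range (fun theta : Theta =>
    'E_(P theta)[fun w => (`|time_average T tau Y t w - m theta| ^+ 2)%R]%E))).
  apply/tends_to_0P => e e0.
  (* With r <= 1 and r <= e / 8, 2 * (e / 8) + 2 * r ^+ 2 <= e / 2. *)
  pose r := Num.min 1 (e / 8).
  have r0 : 0 < r by rewrite lt_min ltr01 divr_gt0.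
  have r1 : r <= 1 by rewrite ge_min lexx.
  have re : r <= e / 8 by rewrite ge_min lexx orbT.
  have [N1 meanN] := meanP r r0.
  have [N2 covN] := covP _ (divr_gt0 e0 (ltr0n R 8)).
  exists (Num.max 0 (Num.max N1 N2)) => t Tt.
  rewrite !gt_max => /and3P[t0 N1t N2t].
  apply: (@ereal_sup_range_lt _ _ _ (2 * (e / 8) + 2 * r ^+ 2)) => //;
    last first.
    have : r ^+ 2 <= r by rewrite expr2 ger_pMr.
    lra.
  move=> theta; apply/andP; split.
    by rewrite unlock; apply: integral_ge0 => w _; rewrite lee_fin exprn_ge0.
  apply: (time_average_mean_square Ttau mY (YM theta) Tt t0).
    exact: (le_of_ereal_sup_range_lt (covN _ Tt N2t)).
  exact: (le_of_ereal_sup_range_lt (meanN _ Tt N1t)).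
split=> // p eps p2 eps0 /uniform_bound_of_ereal_sup[K K0 YK].
move/tends_to_0P in L2; apply/tends_to_0P => e e0.
set q := p + eps in YK.
have q1 : 1 < q by rewrite /q; lra.
(* B bounds |m| (bias at most 1) and C the centred moments of order q. *)
pose B := 1 + (1 + M); pose C := 2 `^ q * K + 2 `^ q * B `^ q.
have C0 : 0 <= C by rewrite addr_ge0// mulr_ge0// powR_ge0.
(* The level l is chosen so that l `^ (- eps) = L^-1 and C / L <= e / 4; A is
   the second moment that makes the other term e / 4. *)
pose L := 4 * C / e + 1.
have L0 : 0 < L by rewrite ltr_wpDl// divr_ge0 ?mulr_ge0// ltW.
pose l := L `^ eps^-1.
have l0 : 0 < l by rewrite powR_gt0.
have lC : l `^ (- eps) * C <= e / 4.
  rewrite powRN /l -powRrM mulVf ?gt_eqF// powRr1 ?(ltW L0)//.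
  rewrite ler_pdivrMl// /L mulrDl mul1r.
  have -> : 4 * C / e * (e / 4) = C by field; rewrite gt_eqF.
  by rewrite lerDl divr_ge0// ltW.
pose A := e / 4 / l `^ (p - 2).
have A0 : 0 < A by rewrite !divr_gt0// powR_gt0.
have [N1 L2N] := L2 A A0.
have [N2 meanN] := meanP 1 ltr01.
exists (Num.max 0 (Num.max N1 N2)) => t Tt.
rewrite !gt_max => /and3P[t0 N1t N2t].
apply: (@ereal_sup_range_lt _ _ _
  (l `^ (p - 2) * A + l `^ (- eps) * C)) => //; last first.
  have -> : l `^ (p - 2) * A = e / 4.
    by rewrite /A mulrC divfK// gt_eqF// powR_gt0.
  lra.
move=> theta; apply/andP; split.
  by rewrite unlock; apply: integral_ge0 => w _; rewrite lee_fin powR_ge0.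
have mt := measurable_time_average Ttau mY Tt t0.
apply: moment_interpolation => //.
- exact: measurable_funB.
- exact: (le_of_ereal_sup_range_lt (L2N _ Tt N1t)).
- apply: moment_shift_le => //; first lra.
  + apply: (mean_limit_le Ttau mY (YM theta) Tt t0).
    exact: (le_of_ereal_sup_range_lt (meanN _ Tt N2t)).
  + exact: (time_average_moment Ttau mY Tt t0 q1 (YK theta)).
Qed.
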